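(* Suppose there is a function $F$ from finite groups to natural numbers such that, whenever $G$ is an integrable finite group, $F(G)$ is a bound for the exponent of the centre $Z(H)$ of some integral $H$ of $G$. Then there is a function $F^*$ from finite groups to natural numbers such that, whenever $G$ is an integrable finite group, $G$ has an integral of order at most $F^*(G)$.
   Context: For a group $H$, $H'$ denotes the derived group (commutator subgroup) of $H$. An integral of a group $G$ is a group $H$ such that $H' \cong G$. A group $G$ is integrable if it has an integral. *)

(* Defs.v *)
From HB Require Import structures.
From mathcomp Require Import all_boot all_fingroup.
From mathcomp Require Import boolp classical_sets.

Set Implicit Arguments.
Unset Strict Implicit.
Unset Printing Implicit Defensive.

Local Open Scope classical_set_scope.
Local Open Scope group_scope.

(* An integral of a finite group may be infinite, so the notions below are
   stated for an arbitrary [groupType]; subgroups are classical sets. *)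

Definition derived (H : groupType) : set H :=
  smallest [set A : set H | group_closed [in A]]
           [set z | exists x y : H, z = [~ x, y]].
Arguments derived H : clear implicits.

Definition centre (H : groupType) : set H :=
  [set z | forall x : H, commute z x].
Arguments centre H : clear implicits.

(* [f] is an isomorphism from [G] onto the subgroup [A] of [H]. *)
Definition isomorphic_to (G H : groupType) (A : set H) : Prop :=
  exists f : {multiplicative G -> H}, injective f /\ range f = A.

Definition is_integral (H G : groupType) : Prop :=
  isomorphic_to G (derived H).

Definition integrable (G : groupType) : Prop :=
  exists H : groupType, is_integral H G.

(* No [e] satisfies [has_exponent A e] when [A] has no finite exponent. *)
Definition has_exponent (H : groupType) (A : set H) (e : nat) : Prop :=
  let kills n := 0 < n /\ forall x, A x -> x ^+ n = 1 in
  kills e /\ forall n, kills n -> e <= n.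

(* Main.v *)
Require Import Defs.
From mathcomp Require Import all_boot all_fingroup.
From HB Require Import structures.
From mathcomp Require Import boolp classical_sets cardinality.

(** Since F* only has to exist, it is enough to show that an integrable finite
    group G has some finite integral, and then to choose such an integral for
    each G and let F* be its order. The hypothesis supplies an integral H of G
    whose centre is killed by some e > 0. Such an H may be infinite; a finite
    subgroup of it with the same derived group is built as follows.

    H is torsion. Conjugation by x permutes the finite group H', so some power
    u of x centralises H'; for such a u the map [u, _] satisfies
    [u ^ k, y] = [u, y] ^ k, hence u ^ |G| is central ([power_central]), and
    (u ^ |G|) ^ e = 1 ([integral_torsion]).

    Only finitely many commutators occur in H, so finitely many elements of H
    already produce all of them ([finite_representatives]). Adjoin these
    elements to H' one at a time: every subgroup containing H' is normal in H,
    so adjoining a torsion element x to a finite such subgroup A gives the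
    finite subgroup A <x> ([finite_adjoin]). The resulting finite subgroup K
    is such that every commutator of H is a commutator of elements of K, so
    K' = H' ([derived_image]) is isomorphic to G. *)

Set Implicit Arguments.
Unset Strict Implicit.
Unset Printing Implicit Defensive.

Local Open Scope group_scope.
Local Open Scope classical_set_scope.

(** * Multiplicative maps between groups *)

Lemma multiplicative1 (G H : groupType) (f : {multiplicative G -> H}) : f 1 = 1.
Proof. by apply: (mulgI (f 1)); rewrite -gmulfM !mulg1. Qed.

Lemma multiplicativeV (G H : groupType) (f : {multiplicative G -> H}) :
  {morph f : x / x^-1}.
Proof.
by move=> x; apply: (mulgI (f x)); rewrite -gmulfM !mulgV multiplicative1.
Qed.

Lemma multiplicativeX (G H : groupType) (f : {multiplicative G -> H}) n :
  {morph f : x / x ^+ n}.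
Proof.
move=> x; elim: n => [|n IHn]; first by rewrite !expg0 multiplicative1.
by rewrite !expgS gmulfM IHn.
Qed.

Lemma multiplicativeR (G H : groupType) (f : {multiplicative G -> H}) :
  {morph f : x y / [~ x, y]}.
Proof. by move=> x y; rewrite !gmulfM !multiplicativeV. Qed.

(** * The derived group *)

Lemma set_group_closedP (H : groupType) (A : set H) :
  group_closed [in A] <-> A 1 /\ forall x y, A x -> A y -> A (x * y^-1).
Proof.
split=> [[A1 AV]|[A1 AV]].
  split=> [|x y Ax Ay]; first by rewrite inE in A1.
  by have := AV x y; rewrite !inE => /(_ Ax Ay).
by split=> [|x y]; rewrite !inE //; apply: AV.
Qed.

Lemma derived_commg (H : groupType) (x y : H) : derived H [~ x, y].
Proof. by move=> A [_]; apply; exists x, y. Qed.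

Lemma derived_group_closed (H : groupType) : group_closed [in derived H].
Proof.
apply/set_group_closedP; split=> [A [/set_group_closedP[A1 _] _] //|].
by move=> x y Hx Hy A AP; have [/set_group_closedP[_ AV] _] := AP; apply: AV;
  [apply: Hx|apply: Hy].
Qed.

Lemma derived_sub (H : groupType) (A : set H) :
  group_closed [in A] -> (forall x y, A [~ x, y]) -> derived H `<=` A.
Proof. by move=> gA cA z; apply; split=> // _ [x [y ->]]. Qed.

(** Subgroups containing all commutators are normal, because
    a ^ x = a [a, x]. *)
Lemma conjg_mem (H : groupType) (A : set H) :
  group_closed [in A] -> (forall x y, A [~ x, y]) ->
  forall a x, A a -> A (a ^ x).
Proof.
move=> gA cA a x Aa; have := group_closedM gA => /(_ a [~ a, x]).
by rewrite !inE commgEl mulKVg; apply=> //; rewrite -commgEl.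
Qed.

(** * Adjoining torsion elements to a finite normal subgroup *)

(** The subgroup B is A <x>, a product of a normal subgroup with a cyclic
    one. *)
Lemma finite_adjoin (H : groupType) (A : set H) (x : H) (n : nat) :
  finite_set A -> group_closed [in A] -> (forall y z, A [~ y, z]) ->
  0 < n -> x ^+ n = 1 ->
  exists B : set H,
    [/\ finite_set B, group_closed [in B], A `<=` B & B x].
Proof.
move=> finA gA cA n_gt0 xn1; have [A1 AV] := (set_group_closedP A).1 gA.
exists [set z | exists a i, A a /\ z = a * x ^+ i]; split.
- apply: sub_finite_set
    (finite_image2 (fun a i => a * x ^+ i) finA (finite_II n)).
  move=> _ [a [i [Aa ->]]]; exists a => //; exists (i %% n);
    first exact: ltn_pmod.
  by rewrite [in RHS](divn_eq i n) mulnC expgD expgM xn1 expg1n mul1g.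
- apply/set_group_closedP; split; first by exists 1, 0%N; rewrite expg0 mulg1.
  move=> _ _ [a [i [Aa ->]]] [b [j [Ab ->]]].
  (* [x ^- j] is a nonnegative power of [x] because [x] has finite order. *)
  have xVj : x ^- j = x ^+ (n.-1 * j)%N.
    apply: (mulgI (x ^+ j)).
    by rewrite mulgV -expgD -mulSn prednK // expgM xn1 expg1n.
  (* (a x^i) (b x^j)^-1 = a (b^-1)^(x^-k) x^k for k = i + (n - 1) j. *)
  exists (a * (b ^ x ^- (i + n.-1 * j)%N)^-1), (i + n.-1 * j)%N; split.
    by apply: AV => //; apply: conjg_mem.
  rewrite invgM xVj -conjVg conjgE invgK !mulgA mulgVK.
  by rewrite -[a * _ * _]mulgA -expgD.
- by move=> a Aa; exists a, 0%N; rewrite expg0 mulg1.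
- by exists 1, 1%N; rewrite expg1 mul1g.
Qed.

Lemma finite_adjoin_seq (H : groupType) (A : set H) (s : seq H) :
  finite_set A -> group_closed [in A] -> (forall y z, A [~ y, z]) ->
  (forall x : H, exists2 n, 0 < n & x ^+ n = 1) ->
  exists B : set H,
    [/\ finite_set B, group_closed [in B], A `<=` B & {in s, forall x, B x}].
Proof.
move=> finA gA cA torsion.
elim: s => [|x s [B [finB gB sAB sB]]]; first by exists A; split.
have [n n_gt0 xn1] := torsion x.
have [C [finC gC sBC Cx]] :=
  finite_adjoin finB gB (fun y z => sAB _ (cA y z)) n_gt0 xn1.
exists C; split=> // [z /sAB /sBC //|z].
by rewrite inE => /predU1P[-> //|/sB /sBC].
Qed.

(** * Finite subgroups as finite groups *)

(** The closure proof is a parameter so that the group structure declared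
    below can be inferred from the type. *)
Definition seq_subgroup (H : groupType) (s : seq H)
  (sG : group_closed (mem s)) : Type := seq_sub s.

HB.instance Definition _ (H : groupType) (s : seq H) sG :=
  SubFinite.copy (@seq_subgroup H s sG) (seq_sub s).
HB.instance Definition _ (H : groupType) (s : seq H) sG :=
  SubChoice_isSubGroup.Build H (mem s) (@seq_subgroup H s sG) sG.

Lemma finite_subgroup_embedding (H : groupType) (A : set H) :
  finite_set A -> group_closed [in A] ->
  exists (K : finGroupType) (i : {multiplicative K -> H}),
    injective i /\ range i = A.
Proof.
move=> /finite_seqP[s ->] /set_group_closedP[s1 sV].
have sG : group_closed (mem s) by [].
exists (seq_subgroup sG), (val : seq_subgroup sG -> H); split;
  first exact: val_inj.
apply/seteqP; split=> [_ [x _ <-]|x sx]; first exact: ssvalP x.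
by exists (SeqSub sx).
Qed.

(** * Transporting the derived group to a subgroup *)

(** Both inclusions use minimality of a derived group: the preimage of H' is a
    subgroup of K with all commutators, and the image of K' is a subgroup of H
    with all commutators. *)
Lemma derived_image (K H : groupType) (i : {multiplicative K -> H}) :
  (forall x y : H, exists a b : K, [~ x, y] = [~ i a, i b]) ->
  i @` derived K = derived H.
Proof.
move=> comm_i.
have [K1 KV] := (set_group_closedP _).1 (derived_group_closed K).
have [H1 HV] := (set_group_closedP _).1 (derived_group_closed H).
apply/seteqP; split.
  apply: image_subP.2; apply: derived_sub => [|a b]; last first.
    rewrite /= multiplicativeR; apply: derived_commg.
  apply/set_group_closedP; split=> [|a b Ha Hb].
    by rewrite /= multiplicative1.
  by rewrite /= gmulfM multiplicativeV; apply: HV.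
apply: derived_sub => [|x y].
  apply/set_group_closedP; split; first by exists 1; rewrite ?multiplicative1.
  move=> _ _ [a Ka <-] [b Kb <-]; exists (a * b^-1); first exact: KV.
  by rewrite gmulfM multiplicativeV.
have [a [b ->]] := comm_i x y; exists [~ a, b]; first exact: derived_commg.
by rewrite multiplicativeR.
Qed.

(** The isomorphism onto the image of A factors through i, and the factor is
    multiplicative because i is injective. *)
Lemma isomorphic_to_preimage (G K H : groupType) (i : {multiplicative K -> H})
    (A : set K) :
  injective i -> isomorphic_to G (i @` A) -> isomorphic_to G A.
Proof.
move=> i_inj [f [f_inj fA]].
have /choice[g gP] (x : G) : exists a, A a /\ i a = f x.
  have : range f (f x) by exists x.
  by rewrite fA => -[a Aa <-]; exists a.
have gM : {morph g : x y / x * y}.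
  move=> x y; apply: i_inj; rewrite gmulfM.
  by rewrite (gP _).2 (gP x).2 (gP y).2 gmulfM.
pose gm : {multiplicative G -> K} :=
  HB.pack g (isMultiplicative.Build G K g gM).
exists gm; split=> [x y gxy|].
  by apply: f_inj; rewrite -!(gP _).2; congr (i _).
apply/seteqP; split=> [_ [x _ <-]|a Aa]; first by have [] := gP x.
have [x _ fx] : range f (i a) by rewrite fA; exists a.
by exists x => //; apply: i_inj; rewrite -fx; have [] := gP x.
Qed.

(** * Integrals of finite groups *)

(** Conjugation by x, carried to G, is a permutation of a finite set; the
    exponent is its order. *)
Lemma power_centralises_derived (G : finGroupType) (H : groupType) :
  is_integral H G -> forall x : H,
  exists2 n, 0 < n & forall d, derived H d -> commute d (x ^+ n).
Proof.
move=> [f [f_inj fH]] x.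
have /choice[c fc] (g : G) : exists g', f g' = f g ^ x.
  suff: range f (f g ^ x) by case=> g' _ <-; exists g'.
  rewrite fH; apply: (@conjg_mem _ (derived H)).
  - exact: derived_group_closed.
  - exact: derived_commg.
  - by rewrite -fH; exists g.
have c_inj : injective c.
  by move=> g h cgh; apply/f_inj/(conjg_inj x); rewrite -!fc cgh.
have fcX n g : f ((perm c_inj ^+ n) g) = f g ^ (x ^+ n).
  elim: n => [|n IHn]; first by rewrite !expg0 perm1 conjg1.
  by rewrite !expgSr permM permE fc IHn conjgM.
exists #[perm c_inj]; first exact: order_gt0.
move=> d; rewrite -fH => -[g _ <-].
by rewrite /commute conjgC -fcX expg_order perm1.
Qed.

(** The exponent |G| works for all y at once: if u centralises H' then
    (u ^+ |G|) ^ y = (u [u, y]) ^+ |G| = u ^+ |G| [u, y] ^+ |G|, and the last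
    factor is 1 because [u, y] lies in a copy of G. *)
Lemma power_central (G : finGroupType) (H : groupType) :
  is_integral H G -> forall x : H, exists2 n, 0 < n & centre H (x ^+ n).
Proof.
move=> HG x; have [n n_gt0 xnC] := power_centralises_derived HG x.
have [f [_ fH]] := HG.
exists (n * #|G|)%N => [|y].
  by rewrite muln_gt0 n_gt0; apply/card_gt0P; exists 1.
rewrite expgM; set u := x ^+ n.
have : range f [~ u, y] by rewrite fH; apply: derived_commg.
case=> g _ fg.
have uy1 : [~ u, y] ^+ #|G| = 1.
  have gG1 : g ^+ #|G| = 1.
    have /dvdnP[k] := cardSg (finset.subsetT <[g]>).
    by rewrite cardsT => ->; rewrite mulnC expgM -/#[g] expg_order expg1n.
  by rewrite -fg -multiplicativeX gG1 multiplicative1.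
have uyC : commute u [~ u, y].
  by apply: commute_sym; apply: xnC; apply: derived_commg.
have uy : u ^ y = u * [~ u, y] by rewrite commgEl mulKVg.
by rewrite /commute conjgC conjXg uy expgMn // uy1 mulg1.
Qed.

Lemma integral_torsion (G : finGroupType) (H : groupType) (e : nat) :
  is_integral H G -> has_exponent (centre H) e ->
  forall x : H, exists2 n, 0 < n & x ^+ n = 1.
Proof.
move=> HG [[e_gt0 eZ] _] x; have [n n_gt0 xnZ] := power_central HG x.
by exists (n * e)%N; rewrite ?muln_gt0 ?n_gt0 // expgM eZ.
Qed.

(** Used with the commutator map on pairs: finitely many pairs realise all of
    its values. *)
Lemma finite_representatives (T : choiceType) (U : Type) (h : T -> U)
    (I : finType) (f : I -> U) :
  (forall t, range f (h t)) ->
  exists s : seq T, forall t, exists2 t', t' \in s & h t = h t'.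
Proof.
move=> fh.
have /choice[r rP] (i : I) : exists s : seq T,
    forall t, h t = f i -> exists2 t', t' \in s & h t = h t'.
  have [[t ht]|no] := pselect (exists t, h t = f i).
    by exists [:: t] => t' ht'; exists t; rewrite ?inE // ht'.
  by exists [::] => t ht; case: no; exists t.
exists (flatten [seq r i | i : I]) => t; have [i _ /esym fi] := fh t.
have [t' t's htt'] := rP i t fi; exists t' => //.
by apply/flatten_imageP; exists i.
Qed.

Lemma finite_integral (G : finGroupType) (H : groupType) (e : nat) :
  is_integral H G -> has_exponent (centre H) e ->
  exists K : finGroupType, is_integral K G.
Proof.
move=> HG He; have [f [_ fH]] := HG.
have [s sP] : exists s : seq (H * H), forall t, exists2 t', t' \in s &
    [~ t.1, t.2] = [~ t'.1, t'.2].
  apply: (finite_representatives (f := f)) => t.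
  by rewrite fH; apply: derived_commg.
have finH : finite_set (derived H)
  by rewrite -fH; apply/finite_image/finite_finset.
have [B [finB gB _ sB]] := finite_adjoin_seq (map fst s ++ map snd s) finH
  (derived_group_closed H) (@derived_commg H) (integral_torsion HG He).
have [K [i [i_inj iB]]] := finite_subgroup_embedding finB gB.
exists K; apply: (isomorphic_to_preimage i_inj); rewrite derived_image //.
move=> x y; have [[a b] abs /= ->] := sP (x, y).
have [a' _ <-] : range i a.
  by rewrite iB; apply: sB; rewrite mem_cat (map_f fst abs).
have [b' _ <-] : range i b.
  by rewrite iB; apply: sB; rewrite mem_cat (map_f snd abs) orbT.
by exists a', b'.
Qed.

Theorem theorem2p1 :
  (exists F : finGroupType -> nat,
     forall G : finGroupType, integrable G ->
       exists H : groupType, is_integral H G /\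
         exists e : nat, has_exponent (centre H) e /\ e <= F G) ->
  exists Fstar : finGroupType -> nat,
    forall G : finGroupType, integrable G ->
      exists H : finGroupType, is_integral H G /\ #|H| <= Fstar G.
Proof.
move=> [F FP].
have /choice[Fstar FstarP] (G : finGroupType) : exists n, integrable G ->
    exists H : finGroupType, is_integral H G /\ #|H| <= n.
  have [intG|//] := pselect (integrable G); last by exists 0%N.
  have [H [HG [e [He _]]]] := FP G intG; have [K KG] := finite_integral HG He.
  by exists #|K|; exists K.
by exists Fstar.
Qed.
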